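(* Fix a degree bound $d\in\mathbb{N}_+$. Every monotone hyper-finite graph property (of graphs with maximum degree at most $d$) is testable in the bounded-degree model.
   Context: Bounded-degree model: fix $d\in\mathbb{N}_+$; all graphs considered are finite with maximum degree at most $d$. An $n$-vertex graph $G$ is represented by a function $f_G:[n]\times[d]\to[n]\cup\{*\}$, where $f_G(v,i)$ is the $i$-th neighbor of $v$ if $v$ has at least $i$ neighbors, and $*$ otherwise. A graph property is a family of graphs closed under isomorphism. A graph $G$ on $n$ vertices is $\epsilon$-far from $\mathcal P$ if at least $\epsilon d n$ edge operations (deleting or adding an edge) are needed to turn $G$ into a graph satisfying $\mathcal P$. A tester for $\mathcal P$ with accuracy $\epsilon$ is a randomized algorithm that is given $n$ and black-box access to $f_G$, and accepts every graph satisfying $\mathcal P$ with probability at least $2/3$ and rejects every graph $\epsilon$-far from $\mathcal P$ with probability at least $2/3$; its query complexity $q(n)$ is the maximum number of calls to $f_G$ on any $n$-vertex graph. $\mathcal P$ is testable if for every $\epsilon>0$ there are $c(\epsilon)<\infty$ and a tester with accuracy $\epsilon$ with $\sup_n q(n)<c(\epsilon)$. A property is monotone if every subgraph of a graph in it is also in it. A graph $G=(V,E)$ is $(\delta,k)$-hyper-finite if one can remove at most $\delta|V|$ edges from $G$ and obtain a graph all of whose connected components have at most $k$ vertices. A family of graphs is hyper-finite if for every $\delta>0$ there is a finite $k=k(\delta)$ such that every graph in the family is $(\delta,k)$-hyper-finite. *)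

(* Defs.v *)
From HB Require Import structures.
From mathcomp Require Import all_boot all_order all_algebra.
From mathcomp Require Import reals.

Set Implicit Arguments.
Unset Strict Implicit.
Unset Printing Implicit Defensive.

Import Order.TTheory GRing.Theory Num.Theory.

Definition neighbors n (E : {set {set 'I_n}}) (v : 'I_n) : {set 'I_n} :=
  [set u | [set v; u] \in E].

(* Edges being two-element sets excludes loops, as [set v; v] is a singleton. *)
Definition is_dgraph d n (E : {set {set 'I_n}}) : bool :=
  [forall e in E, #|e| == 2] && [forall v, #|neighbors E v| <= d].

(* Simple graphs with vertex set 'I_n and maximum degree at most d. *)
Record dgraph d n := DGraph {
  edges : {set {set 'I_n}};
  dgraphP : is_dgraph d edges }.

HB.instance Definition _ d n := [isSub for @edges d n].
HB.instance Definition _ d n := [Finite of dgraph d n by <:].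

Definition adj d n (G : dgraph d n) : rel 'I_n :=
  fun u v => [set u; v] \in edges G.

Definition graph_family d := forall n, dgraph d n -> Prop.

Definition isomorphic d n m (G : dgraph d n) (H : dgraph d m) : Prop :=
  exists h : 'I_n -> 'I_m,
    bijective h /\ forall u v, adj H (h u) (h v) = adj G u v.

Definition graph_property d (P : graph_family d) : Prop :=
  forall n m (G : dgraph d n) (H : dgraph d m),
    isomorphic G H -> P n G -> P m H.

(* As vertex sets are initial segments of nat, H is a subgraph of G up to the
   renaming h of its vertices; both vertices and edges may be dropped. *)
Definition subgraph d m n (H : dgraph d m) (G : dgraph d n) : Prop :=
  exists h : 'I_m -> 'I_n,
    injective h /\ forall u v, adj H u v -> adj G (h u) (h v).

Definition monotone_property d (P : graph_family d) : Prop :=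
  forall n m (G : dgraph d n) (H : dgraph d m),
    subgraph H G -> P n G -> P m H.

(* The vertex set of the connected component of v in ('I_n, E). *)
Definition component n (E : {set {set 'I_n}}) (v : 'I_n) : {set 'I_n} :=
  [set u | connect (fun x y => [set x; y] \in E) v u].

Definition hyperfinite_graph (R : realType) d n (delta : R) (k : nat)
    (G : dgraph d n) : Prop :=
  exists F : {set {set 'I_n}},
    [/\ F \subset edges G, (#|F|%:R <= delta * n%:R)%R &
        forall v, #|component (edges G :\: F) v| <= k].

Definition hyperfinite_family (R : realType) d (P : graph_family d) : Prop :=
  forall delta : R, (0 < delta)%R ->
    exists k : nat, forall n (G : dgraph d n),
      P n G -> hyperfinite_graph delta k G.

(* The number of edge deletions plus edge additions turning G into H. *)
Definition edit_distance d n (G H : dgraph d n) : nat :=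
  #|edges G :\: edges H| + #|edges H :\: edges G|.

(* If no n-vertex graph satisfies P, then every G is far from P. *)
Definition far (R : realType) d n (eps : R) (P : graph_family d)
    (G : dgraph d n) : Prop :=
  forall H : dgraph d n,
    P n H -> (eps * d%:R * n%:R <= (edit_distance G H)%:R)%R.

(* The black box f_G, indices being counted from 0; None stands for *. *)
Definition oracle d n := {ffun 'I_n * 'I_d -> option 'I_n}.

(* The neighbors of each vertex may be listed in any order; onth s i is None
   exactly when s has at most i items. *)
Definition represents d n (G : dgraph d n) (f : oracle d n) : bool :=
  [forall v : 'I_n,
     has (fun s => [forall i : 'I_d, f (v, i) == onth s i])
         (permutations (enum (neighbors (edges G) v)))].

(* Randomized query algorithms on n-vertex graphs, as randomized decision
   trees: halt with a verdict (true meaning accept), query the black box, or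
   draw a uniform element of {0, ..., m}. *)
Inductive algorithm d n :=
| Halt of bool
| Query of 'I_n & 'I_d & (option 'I_n -> algorithm d n)
| Sample m of ('I_m.+1 -> algorithm d n).

(* The probability that the verdict is b when the black box is f. *)
Fixpoint prob_verdict (R : realType) d n (b : bool) (f : oracle d n)
    (A : algorithm d n) : R :=
  match A with
  | Halt b' => (b' == b)%:R%R
  | Query v i k => prob_verdict R b f (k (f (v, i)))
  | Sample m k => ((\sum_(x < m.+1) prob_verdict R b f (k x)) / m.+1%:R)%R
  end.

(* The number of queries when the black box is f, for the worst coin tosses. *)
Fixpoint queries d n (f : oracle d n) (A : algorithm d n) : nat :=
  match A with
  | Halt _ => 0
  | Query v i k => (queries f (k (f (v, i)))).+1
  | Sample m k => \max_(x < m.+1) queries f (k x)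
  end.

Definition query_complexity d (T : forall n, algorithm d n) (n : nat) : nat :=
  \max_(G : dgraph d n) \max_(f : oracle d n | represents G f) queries f (T n).

(* Only nonempty graphs are tested: for n = 0 the inequality in far is 0 <= 0,
   so that the null graph would be far from every property, even one that
   contains it. *)
Definition is_tester (R : realType) d (eps : R) (P : graph_family d)
    (T : forall n, algorithm d n) : Prop :=
  forall n (G : dgraph d n) (f : oracle d n), 0 < n -> represents G f ->
    (P n G -> (2 / 3 <= prob_verdict R true f (T n))%R) /\
    (far eps P G -> (2 / 3 <= prob_verdict R false f (T n))%R).

Definition testable (R : realType) d (P : graph_family d) : Prop :=
  forall eps : R, (0 < eps)%R ->
    exists (c : nat) (T : forall n, algorithm d n),
      is_tester eps P T /\ forall n, query_complexity T n < c.

(* Main.v *)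
(** A random partition of G into components of at most k vertices: in each of T
    rounds draw a uniformly random vertex set W, and carve out of the set U of
    remaining vertices those components of G[U :&: W] that have at most k
    vertices and few edges to the rest of U.  If G is hyperfinite, then most
    vertices of U lie in small pieces with few outgoing edges, and W isolates
    such a piece with a probability that depends on k and d only; so the
    expected size of U decreases geometrically down to a small fraction of n,
    and few edges join different parts.

    Which part v belongs to depends only on a ball of constant radius around v.
    The tester draws the sets W and a few vertices, explores their balls, and
    accepts iff the sampled frequencies of the isomorphism types of parts and of
    the numbers of cut edges are close to those of a cheap partition of some
    graph in P.  It accepts graphs in P because they are hyperfinite.  If it
    accepts G on a representative sample, then matching parts of the same type
    shows that G becomes a subgraph of a graph in P, hence a member of P, after
    deleting the cut edges and the edges of the unmatched parts. *)

From HB Require Import structures.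
Require Import Defs.
From mathcomp Require Import all_boot all_order all_algebra.
From mathcomp Require Import boolp reals.
From mathcomp Require Import zify ring lra.

Set Implicit Arguments.
Unset Strict Implicit.
Unset Printing Implicit Defensive.

Import Order.TTheory GRing.Theory Num.Theory.

(** * Components and balls *)

Section Components.
Variable V : finType.
Implicit Types (r : rel V) (v : V) (C : {set V}).

Definition cc r v : {set V} := [set u | connect r v u].

Lemma mem_cc r v : v \in cc r v.
Proof. by rewrite inE connect0. Qed.

Lemma cc_closed r v x y : x \in cc r v -> r x y -> y \in cc r v.
Proof. by rewrite !inE => vx xy; apply: connect_trans vx (connect1 xy). Qed.

Lemma cc_min r v C :
  v \in C -> (forall x y, x \in C -> r x y -> y \in C) -> cc r v \subset C.
Proof.
move=> vC clC; apply/subsetP => u; rewrite inE => /connectP[p pth ->].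
by elim: p v vC pth => //= y p IH v vC /andP[vy /IH]; apply; apply: clC vy.
Qed.

Lemma cc_eq r v u : symmetric r -> u \in cc r v -> cc r u = cc r v.
Proof.
move=> rsym; rewrite inE => vu; apply/setP => w; rewrite !inE.
by rewrite (same_connect (sym_connect_sym rsym) vu).
Qed.

Definition ball r j (X : {set V}) : {set V} :=
  iter j (fun Y => Y :|: \bigcup_(u in Y) [set w | r u w]) X.

Lemma sub_ball r i j X : i <= j -> ball r i X \subset ball r j X.
Proof.
move=> /subnK <-; elim: (j - i) => //= m IH.
exact: subset_trans IH (subsetUl _ _).
Qed.

Lemma ballS r j X u w : u \in ball r j X -> r u w -> w \in ball r j.+1 X.
Proof.
by move=> uB uw; rewrite /= inE; apply/orP; right; apply/bigcupP; exists u; rewrite ?inE.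
Qed.

Lemma ballSr r j (X : {set V}) :
  ball r j.+1 X = ball r j (X :|: \bigcup_(u in X) [set w | r u w]).
Proof. by rewrite /ball iterSr. Qed.

Lemma eq_ball (r r' : rel V) j (X : {set V}) : r =2 r' -> ball r j X = ball r' j X.
Proof.
move=> rr'; elim: j => //= j ->; congr (_ :|: _); apply: eq_bigr => u _.
by apply/setP => w; rewrite !inE rr'.
Qed.

(* Paths are followed along [a'], whose edges are only known near [X]. *)
Lemma path_ball r (a a' : rel V) i k X v p :
  subrel a r ->
  (forall x, x \in ball r (i + k) X -> forall y, a x y = a' x y) ->
  v \in ball r i X -> size p <= k -> path a' v p ->
  last v p \in ball r (i + size p) X.
Proof.
move=> ar; elim: p i k v => [|y p IH] i k v aa' vB /=; first by rewrite addn0.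
case: k aa' => // k aa'; rewrite ltnS => pk /andP[vy yp].
rewrite -addSnnS; apply: (IH _ k) => //.
  by move=> x; rewrite addSnnS; apply: aa'.
have xB : v \in ball r (i + k.+1) X by apply: (subsetP (sub_ball _ _ (leq_addr _ _)) _ vB).
by apply: (ballS vB); apply: ar; rewrite aa'.
Qed.

(** Each vertex of the component is reached by a simple path, which has fewer than [k] edges because
    its vertices all lie in the component. Such a path cannot leave the region where [a'] agrees
    with [a]. *)
Lemma small_cc_ball r (a a' : rel V) i k X v :
  subrel a r ->
  (forall x, x \in ball r (i + k) X -> forall y, a x y = a' x y) ->
  v \in ball r i X -> #|cc a' v| <= k -> cc a' v \subset ball r (i + k) X.
Proof.
move=> ar aa' vB ck; apply/subsetP => u; rewrite inE => /connectP[p0 pth0 ->].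
case: (shortenP pth0) => p pth uniqp _.
have pk : size p <= k.
  apply: leq_trans ck; apply: leq_trans (leqnSn _) _.
  rewrite -[(size p).+1]/(size (v :: p)) -(card_uniqP uniqp); apply: subset_leq_card.
  by apply/subsetP => x xp; rewrite inE; apply: (path_connect pth).
apply: (subsetP (sub_ball _ _ _)) (path_ball ar aa' vB pk pth).
by rewrite leq_add2l.
Qed.

(** Whichever of the two components is small stays inside the region where the relations agree, so
    it is closed under both. *)
Lemma cc_local r (a a' : rel V) i k X v :
  subrel a r ->
  (forall x, x \in ball r (i + k) X -> forall y, a x y = a' x y) ->
  v \in ball r i X -> (#|cc a v| <= k) || (#|cc a' v| <= k) ->
  cc a v = cc a' v.
Proof.
move=> ar aa' vB; have aE x xB := aa' x xB.
have aux (b c : rel V) : cc b v \subset ball r (i + k) X ->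
    (forall x, x \in ball r (i + k) X -> forall y, b x y = c x y) ->
    cc b v = cc c v.
  move=> bB bc; apply/eqP; rewrite eqEsubset; apply/andP; split; last first.
    apply: cc_min (mem_cc _ _) _ => x y xb; rewrite -bc ?(subsetP bB) //.
    exact: cc_closed.
  suff: cc b v \subset cc b v :&: cc c v by rewrite subsetI => /andP[].
  apply: cc_min => [|x y]; first by rewrite inE !mem_cc.
  rewrite inE => /andP[xb xc] bxy; rewrite inE (cc_closed xb bxy).
  by apply: cc_closed xc _; rewrite -bc // (subsetP bB).
case/orP => ck; [apply: aux => //|symmetry; apply: aux => [|x xB y]].
- exact: (small_cc_ball ar (fun _ _ _ => erefl) vB ck).
- exact: (small_cc_ball ar aa' vB ck).
- by rewrite aa'.
Qed.

End Components.

(** * Carving *)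

Section Carving.
Variables (V : finType) (k q : nat) (e : rel V).
Implicit Types (U W : {set V}) (ws : seq {set V}) (v : V).

Definition induced (A : {set V}) : rel V := [rel x y | [&& x \in A, y \in A & e x y]].

Definition boundary U (S : {set V}) : {set V * V} :=
  [set p | [&& p.1 \in S, p.2 \in U :\: S & e p.1 p.2]].

(** The ratio [1 / q] is the number of outgoing edges allowed per vertex. These are counted towards
    all of [U], not just [U :&: W], since carving cuts them all. *)
Definition carved U W : {set V} :=
  [set v in U :&: W | let S := cc (induced (U :&: W)) v in
     (#|S| <= k) && (q * #|boundary U S| <= #|S|)].

Fixpoint leftover U ws : {set V} :=
  if ws is W :: ws' then leftover (U :\: carved U W) ws' else U.

(** Adjacent vertices carved in the same round both lie in [U :&: W], hence in the same component,
    so parts need not be named. Leftover vertices become isolated. *)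
Fixpoint kept U ws : rel V :=
  if ws is W :: ws' then
    [rel x y | [&& x \in carved U W, y \in carved U W & e x y]
               || kept (U :\: carved U W) ws' x y]
  else [rel x y | false].

Definition unkept U ws : {set V * V} :=
  [set p | [&& p.1 \in U, p.2 \in U, e p.1 p.2 & ~~ kept U ws p.1 p.2]].

Lemma carvedUI U W : carved U W \subset U :&: W.
Proof. by apply/subsetP => v; rewrite [v \in carved U W]inE => /andP[]. Qed.

Lemma carvedU U W : carved U W \subset U.
Proof. exact: subset_trans (carvedUI U W) (subsetIl _ _). Qed.

Lemma kept_sub U ws x y : kept U ws x y -> [/\ x \in U, y \in U & e x y].
Proof.
elim: ws U => //= W ws IH U /orP[/and3P[/(subsetP (carvedU _ _)) ? /(subsetP (carvedU _ _)) ? ?] //|].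
by case/IH; rewrite !inE => /andP[_ ?] /andP[_ ?].
Qed.

Hypothesis e_sym : symmetric e.

Lemma kept_sym U ws : symmetric (kept U ws).
Proof.
elim: ws U => //= W ws IH U x y /=; rewrite IH; congr orb.
rewrite e_sym andbCA.
by rewrite andbCA.
Qed.

Lemma induced_sym A : symmetric (induced A).
Proof. by move=> x y; rewrite /induced /= e_sym andbCA. Qed.

Lemma carved_cc U W v :
  v \in carved U W -> cc (induced (U :&: W)) v \subset carved U W.
Proof.
move=> vD; have vUW := subsetP (carvedUI U W) _ vD.
apply/subsetP => u uS.
have uUW : u \in U :&: W.
  apply: (subsetP (cc_min vUW _)) uS.
  by move=> x y _ /and3P[].
rewrite inE uUW (cc_eq (@induced_sym _) uS) /=.
by move: vD; rewrite inE => /andP[].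
Qed.

(** Later rounds only join vertices outside the carved set, so a carved vertex stays in its small
    component and any other vertex never enters the carved set. Leftover vertices form singletons,
    whence [0 < k]. *)
Lemma card_cc_kept U ws v : 0 < k -> #|cc (kept U ws) v| <= k.
Proof.
move=> k0; elim: ws U v => [|W ws IH] U v.
  apply: leq_trans k0; rewrite -(cards1 v); apply: subset_leq_card.
  by apply: cc_min => //; rewrite inE.
have [vD|vD] := boolP (v \in carved U W).
  apply: (@leq_trans #|cc (induced (U :&: W)) v|); last first.
    by move: vD; rewrite inE => /and3P[].
  apply: subset_leq_card; apply: cc_min (mem_cc _ _) _ => x y xS /=.
  have xD := subsetP (carved_cc vD) _ xS.
  case/orP => [/and3P[_ yD xy]|/kept_sub[]]; last by rewrite inE xD.
  apply: cc_closed xS _.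
  by rewrite /induced /= !(subsetP (carvedUI U W)).
apply: leq_trans (IH (U :\: carved U W) v); apply: subset_leq_card.
have CD : cc (kept (U :\: carved U W) ws) v \subset ~: carved U W.
  apply: cc_min => [|x y _ /kept_sub[_]]; first by rewrite inE.
  by rewrite !in_setD in_setC => /andP[].
apply: cc_min (mem_cc _ _) _ => x y xC /= /orP[/and3P[xD _ _]|].
  by move: (subsetP CD _ xC); rewrite in_setC xD.
exact: cc_closed.
Qed.

Variable d : nat.
Hypothesis edeg : forall v, #|[set u | e v u]| <= d.

Lemma card_pairs_from (A : {set V}) :
  #|[set p : V * V | (p.1 \in A) && e p.1 p.2]| <= d * #|A|.
Proof.
rewrite -sum1dep_card; rewrite (eq_bigl (fun p => (p.1 \in A) && (p.2 \in [set u | e p.1 u]))); last first.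
  by move=> p; rewrite inE.
rewrite -(pair_big_dep (mem A) (fun v u => u \in [set u | e v u]) (fun _ _ => 1)) /=.
rewrite mulnC -sum_nat_const; apply: leq_sum => v _.
by rewrite sum1_card edeg.
Qed.

(** The carved components partition the carved set, and their boundaries cover its boundary, so the
    bounds for single components add up. *)
Lemma card_boundary_carved U W :
  q * #|boundary U (carved U W)| <= #|carved U W|.
Proof.
set D := carved U W; pose S v := cc (induced (U :&: W)) v.
have SD u v : u \in D -> v \in S u -> v \in D by move=> /carved_cc/subsetP; apply.
have bD : boundary U D \subset \bigcup_(C in S @: D) boundary U C.
  apply/subsetP => p; rewrite inE => /and3P[p1 /setDP[p2 p2D] ep].
  apply/bigcupP; exists (S p.1); first exact: imset_f.
  rewrite inE mem_cc ep inE p2 /= !andbT.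
  by apply: contra p2D; apply: SD.
have leU : #|\bigcup_(C in S @: D) boundary U C| <= \sum_(C in S @: D) #|boundary U C|.
  elim/big_ind2: _ => [|A m B n Am Bn|//]; first by rewrite cards0.
  exact: leq_trans (leq_card_setU _ _) (leq_add Am Bn).
apply: (@leq_trans (\sum_(C in S @: D) #|C|)).
  apply: leq_trans (_ : q * \sum_(C in S @: D) #|boundary U C| <= _).
    by rewrite leq_mul2l (leq_trans (subset_leq_card bD) leU) orbT.
  rewrite big_distrr; apply: leq_sum => C /imsetP[v vD ->].
  by move: vD; rewrite inE => /and3P[].
rewrite -[leqRHS]sum1_card (partition_big_imset S) /=; apply: leq_sum => C /imsetP[v vD ->].
rewrite sum1dep_card; apply: subset_leq_card; apply/subsetP => u uS.
by rewrite inE (SD v) //= /S (cc_eq (@induced_sym _) uS).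
Qed.

(** A pair is cut either in a round, crossing the boundary of the carved set in one of two
    directions, or at the end, starting from a leftover vertex. The carved sets are disjoint, so the
    boundary terms sum to at most [2 * #|U|]. *)
Lemma card_unkept U ws :
  q * #|unkept U ws| <= 2 * #|U| + q * d * #|leftover U ws|.
Proof.
elim: ws U => [|W ws IH] U /=.
  rewrite -mulnA; apply: leq_trans (leq_addl _ _); rewrite leq_mul2l; apply/orP; right.
  apply: leq_trans (card_pairs_from U); apply: subset_leq_card.
  by apply/subsetP => p; rewrite !inE => /and4P[-> _ ->].
set D := carved U W; set U' := U :\: D.
pose B := boundary U D; pose B' : {set V * V} := [set (p.2, p.1) | p in B].
have uU : unkept U (W :: ws) \subset B :|: B' :|: unkept U' ws.
  apply/subsetP => -[x y]; rewrite inE /= -/D -/U' => /and4P[xU yU xy].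
  rewrite negb_or; case/andP => nD nk; rewrite !in_setU.
  have [xD|xD] := boolP (x \in D).
    have yD : y \notin D by apply: contra nD => yD; rewrite xD yD xy.
    by rewrite [_ \in B]inE /= xD inE yD yU xy.
  have [yD|yD] := boolP (y \in D).
    apply/orP; left; apply/orP; right; apply/imsetP; exists (y, x) => //.
    by rewrite inE /= yD inE xD xU e_sym xy.
  by apply/orP; right; rewrite inE /= !(in_setD, xD, yD, xU, yU, xy).
apply: leq_trans (_ : q * (#|B| + #|B'| + #|unkept U' ws|) <= _).
  rewrite leq_mul2l; apply/orP; right; apply: leq_trans (subset_leq_card uU) _.
  apply: leq_trans (leq_card_setU _ _) _; rewrite leq_add2r.
  exact: leq_card_setU.
have B'B : #|B'| <= #|B| by apply: leq_imset_card.
have qB : q * #|B| <= #|D| by apply: card_boundary_carved.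
have DU : #|U| = #|D| + #|U'|.
  rewrite -(cardsID D U); congr (_ + _); congr #|pred_of_set _|.
  by apply/setIidPr; apply: carvedU.
have qB' : q * #|B'| <= #|D| by apply: leq_trans qB; rewrite leq_mul2l B'B orbT.
have := IH U'; rewrite DU !mulnDr; lia.
Qed.

End Carving.

(** * Expected size of the leftover under random carving *)

Lemma big_tupleS (R : nmodType) (T : finType) n (F : seq T -> R) :
  (\sum_(t : n.+1.-tuple T) F t = \sum_(x : T) \sum_(t : n.-tuple T) F (x :: t))%R.
Proof.
rewrite pair_bigA /=.
rewrite (reindex (fun p : T * n.-tuple T => [tuple of p.1 :: p.2])) //=.
exists (fun t => (thead t, behead_tuple t)) => [[x t] _|t _] /=.
  by congr pair; apply: val_inj.
by rewrite [RHS]tuple_eta.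
Qed.

(** A uniformly random [W] contains [A] and avoids [B] with probability [2 ^- (#|A| + #|B|)]:
    outside [A :|: B] it is arbitrary. *)
Lemma card_sets_between (V : finType) (A B : {set V}) : [disjoint A & B] ->
  2 ^ #|V| <= 2 ^ (#|A| + #|B|) * #|[set W : {set V} | (A \subset W) && [disjoint B & W]]|.
Proof.
move=> AB; set Z := ~: (A :|: B).
have cZ : #|A| + #|B| + #|Z| = #|V|.
  by rewrite -(cardsC (A :|: B)) cardsU (disjoint_setI0 AB) cards0 subn0.
rewrite -cZ expnD leq_mul2l expn_eq0 /= -card_powerset.
rewrite -(card_in_imset (f := fun X => A :|: X) (D := powerset Z)); last first.
  move=> X Y; rewrite !powersetE => XZ YZ /setP XY; apply/setP => x.
  have := XY x; have := subsetP XZ x; have := subsetP YZ x; rewrite !inE.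
  by case: (x \in A); case: (x \in B); case: (x \in X); case: (x \in Y) => //= h1 h2;
    try (by have := h1 isT); try (by have := h2 isT).
apply: subset_leq_card; apply/subsetP => _ /imsetP[X XZ ->].
rewrite inE subsetUl /= disjoint_sym disjoints_subset; apply/subsetP => x; rewrite !inE.
case/orP => [xA|xX]; first by rewrite (disjointFr AB).
by move: XZ; rewrite powersetE => /subsetP/(_ _ xX); rewrite !inE negb_or => /andP[].
Qed.

Section Expectation.
Variables (V : finType) (k q d : nat) (e : rel V).
Hypothesis e_sym : symmetric e.
Hypothesis edeg : forall v, #|[set u | e v u]| <= d.

Local Notation carved := (carved k q e).
Local Notation leftover := (leftover k q e).

Section OneRound.
Variables (r : rel V) (U : {set V}).
Hypothesis r_sym : symmetric r.
Hypothesis rcc : forall v, #|cc r v| <= k.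

(** In the application [r] is adjacency after deleting the edges that hyperfiniteness provides. Its
    components within [U] are the pieces that a round hopes to isolate. *)
Let rU : rel V := [rel x y | [&& x \in U, y \in U & r x y]].
Let C v := cc rU v.
Let good v := q * #|boundary e U (C v)| <= #|C v|.
Let lost : {set V * V} := [set p | e p.1 p.2 && ~~ r p.1 p.2].

Let rU_sym : symmetric rU.
Proof. by move=> x y; rewrite /rU /= r_sym andbCA. Qed.

Let CU v : v \in U -> C v \subset U.
Proof. by move=> vU; apply: cc_min => // x y _ /and3P[]. Qed.

(** A bad component [S] has more than [#|S| / q] outgoing pairs. All of them are lost, and the first
    vertex of a pair tells which component it leaves, so none is counted twice. *)
Let card_bad : #|[set v in U | ~~ good v]| <= q * #|lost|.
Proof.
set bad := [set v in U | _].
apply: (@leq_trans (\sum_(S in C @: bad) q * #|boundary e U S|)).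
  rewrite -sum1_card (partition_big_imset C) /=; apply: leq_sum => _ /imsetP[v vb ->].
  apply: (@leq_trans #|C v|); last first.
    by move: vb; rewrite inE /good -ltnNge => /andP[_ /ltnW].
  rewrite sum1dep_card; apply: subset_leq_card; apply/subsetP => u.
  by rewrite inE => /andP[_ /eqP <-]; apply: mem_cc.
rewrite -big_distrr leq_mul2l /=; apply/orP; right.
rewrite -[leqRHS]sum1_card (partition_big (fun p => C p.1) predT) //=.
rewrite [leqRHS](bigID (mem (C @: bad))) /=.
apply: leq_trans (leq_addr _ _); apply: leq_sum => _ /imsetP[v vb ->].
have vU : v \in U by move: vb; rewrite inE => /andP[].
rewrite sum1dep_card; apply: subset_leq_card; apply/subsetP => p.
rewrite inE => /and3P[p1 /setDP[p2 p2C] ep].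
rewrite !inE ep /C (cc_eq rU_sym p1) eqxx andbT /=.
apply: contra p2C => rp; apply: (cc_closed p1).
by rewrite /rU /= rp p2 (subsetP (CU vU) _ p1).
Qed.

Hypothesis re : subrel r e.

(** If [W] contains [C v] and avoids the set [N] of its outer neighbors in [U], then [C v] is
    exactly a component of the graph induced on [U :&: W], hence carved. These two sets have at most
    [k] and [d * k] elements. *)
Let card_good v : v \in U -> good v ->
  2 ^ #|V| <= 2 ^ (k + d * k) * #|[set W | v \in carved U W]|.
Proof.
move=> vU gv.
pose N := [set w in U :\: C v | [exists u in C v, e u w]].
have cN : #|N| <= d * k.
  apply: leq_trans (_ : d * #|C v| <= _); last first.
    rewrite leq_mul2l (leq_trans _ (rcc v)) ?orbT //; apply: subset_leq_card.
    apply: cc_min (mem_cc _ _) _ => x y xC /and3P[_ _]; exact: cc_closed xC.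
  apply: leq_trans (card_pairs_from edeg (C v)).
  apply: leq_trans (leq_imset_card snd _); apply: subset_leq_card.
  apply/subsetP => w; rewrite inE => /andP[_ /existsP[u /andP[uC uw]]].
  by apply/imsetP; exists (u, w) => //; rewrite inE uC.
have cC : #|C v| <= k.
  apply: leq_trans (rcc v); apply: subset_leq_card.
  by apply: cc_min (mem_cc _ _) _ => x y xC /and3P[_ _]; apply: cc_closed xC.
have dCN : [disjoint C v & N].
  by rewrite disjoint_sym disjoints_subset; apply/subsetP => w; rewrite !inE => /andP[/andP[]].
apply: leq_trans (card_sets_between dCN) _; apply: leq_mul.
  by rewrite leq_exp2l // leq_add.
apply: subset_leq_card; apply/subsetP => W; rewrite !inE => /andP[CW NW].
have vW := subsetP CW _ (mem_cc _ _).
suff -> : cc (induced e (U :&: W)) v = C v by rewrite vU vW /= cC.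
apply/eqP; rewrite eqEsubset; apply/andP; split.
  apply: cc_min (mem_cc _ _) _ => x y xC /and3P[_]; rewrite inE => /andP[yU yW] xy.
  rewrite -[_ \in _]negbK; apply/negP => yC; case/negP: (negbT (disjointFl NW yW)).
  by rewrite 2!inE yC yU; apply/existsP; exists x; rewrite xC.
suff: C v \subset C v :&: cc (induced e (U :&: W)) v by rewrite subsetI => /andP[].
apply: cc_min => [|x y]; first by rewrite inE !mem_cc.
rewrite inE => /andP[xC xc] xy; rewrite inE (cc_closed xC xy).
apply: cc_closed xc _; have yC := cc_closed xC xy.
case/and3P: xy => xU yU /re xy.
by rewrite /induced /= !inE xU yU xy !(subsetP CW).
Qed.

Lemma sum_carved :
  2 ^ #|V| * #|U| <=
  2 ^ (k + d * k) * (\sum_(W : {set V}) #|carved U W|) + 2 ^ #|V| * (q * #|lost|).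
Proof.
pose bad := [set v in U | ~~ good v]; pose gd := [set v in U | good v].
have -> : #|U| = #|gd| + #|bad|.
  rewrite -(cardsID [set v | good v] U); congr (_ + _); apply: eq_card => v; rewrite !inE //.
  by rewrite andbC.
rewrite mulnDr; apply: leq_add; last by rewrite leq_mul2l card_bad orbT.
(* Double counting of the pairs of a set [W] and a vertex carved by it. *)
have -> : \sum_(W : {set V}) #|carved U W| = \sum_v #|[set W | v \in carved U W]|.
  transitivity (\sum_(W : {set V}) \sum_v (v \in carved U W : nat)).
    by apply: eq_bigr => W _; rewrite -sum1_card big_mkcond; apply: eq_bigr => v _; case: (v \in _).
  rewrite exchange_big; apply: eq_bigr => v _; rewrite -sum1_card [RHS]big_mkcond.
  by apply: eq_bigr => W _; rewrite [W \in _]inE; case: (v \in _).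
rewrite (bigID (mem gd)) /= mulnDr; apply: leq_trans (leq_addr _ _).
rewrite mulnC -sum_nat_const big_distrr; apply: leq_sum => v.
by rewrite inE => /andP[vU gv]; apply: card_good.
Qed.

End OneRound.

Local Open Scope ring_scope.

(* [p] bounds from below the chance that a given cheap component is carved. *)
Lemma sum_leftover (R : realFieldType) (r : rel V) (p b : R) T (U : {set V}) :
  symmetric r -> subrel r e -> (forall v, #|cc r v| <= k)%N ->
  p = (2 ^ (k + d * k))%:R^-1 ->
  b = (q * #|[set x | e x.1 x.2 && ~~ r x.1 x.2]|)%:R ->
  \sum_(ws : T.-tuple {set V}) #|leftover U ws|%:R
    <= (2 ^ #|V|)%:R ^+ T * (b + (1 - p) ^+ T * (#|U|%:R - b)) :> R.
Proof.
move=> r_sym re rcc pE bE; move eN: (2 ^ #|V|)%:R => N.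
have N0 : 0 <= N by rewrite -eN ler0n.
have M1 : 1 <= (2 ^ (k + d * k))%:R :> R by rewrite ler1n expn_gt0.
have p01 : 0 <= 1 - p.
  by rewrite subr_ge0 pE invf_le1 // (lt_le_trans ltr01 M1).
elim: T U => [|T IH] U.
  rewrite (eq_bigr (fun=> #|U|%:R)) => [|ws _]; last by rewrite tuple0.
  by rewrite sumr_const card_tuple expn0 mulr1n !expr0 !mul1r addrC subrK.
rewrite (big_tupleS _ (fun ws => #|leftover U ws|%:R)) /=.
apply: le_trans (ler_sum _ (fun W _ => IH _)) _.
rewrite -mulr_sumr [in leRHS]exprSr -[leRHS]mulrA ler_wpM2l ?exprn_ge0 //.
have cN : #|{set V}|%:R = N by rewrite -cardsT -powersetT card_powerset cardsT eN.
rewrite big_split /= -mulr_sumr sumrB !sumr_const /= -[b *+ _]mulr_natr cN.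
(* One round shrinks the expected excess of the remaining set over [b] by the factor [1 - p]; the
   level [b], due to bad vertices, is the fixed point of the recursion. *)
set S := \sum_W _; suff SN : S - b * N <= N * ((1 - p) * (#|U|%:R - b)).
  apply: le_trans (lerD (lexx _) (ler_wpM2l (exprn_ge0 T p01) SN)) _.
  by rewrite exprS le_eqVlt; apply/orP; left; apply/eqP; ring.
have -> : S = N * #|U|%:R - \sum_W #|carved U W|%:R.
  rewrite -cN mulrC mulr_natr -sumr_const -sumrB; apply: eq_bigr => W _.
  by rewrite cardsDS ?carvedU // natrB // subset_leq_card // carvedU.
have := @sum_carved r U r_sym rcc re.
rewrite -(ler_nat R) natrD !natrM natr_sum eN -natrM -bE => le1.
have p0 : 0 <= p by rewrite pE invr_ge0 ler0n.
have pM : p * (2 ^ (k + d * k))%:R = 1 by rewrite pE mulVf // gt_eqF // (lt_le_trans ltr01 M1).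
have := ler_wpM2l p0 le1; rewrite [in leRHS]mulrDr [in leRHS]mulrA pM mul1r.
by move: (\sum_W _) => Sc; lra.
Qed.

End Expectation.

(** * Locality *)

Section Locality.
Variables (V : finType) (k q : nat) (e e' : rel V) (X : {set V}).

(** Radius [k] covers a component of admissible size, and one more step covers the outer ends of its
    boundary. Components too large on both sides fail both tests and need not be explored. *)
Lemma carved_local i (U U' W : {set V}) :
  (forall x, x \in ball e (i + k).+1 X -> (x \in U) = (x \in U')) ->
  (forall x, x \in ball e (i + k) X -> forall y, e x y = e' x y) ->
  forall x, x \in ball e i X ->
    (x \in carved k q e U W) = (x \in carved k q e' U' W).
Proof.
move=> UU' ee' x xB.
have UW y : y \in ball e (i + k).+1 X -> (y \in U :&: W) = (y \in U' :&: W).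
  by move=> yB; rewrite !inE UU'.
have sB y : y \in ball e (i + k) X -> y \in ball e (i + k).+1 X.
  exact: (subsetP (sub_ball e X (leqnSn (i + k)))). 
rewrite [LHS]inE [RHS]inE (UW x); last first.
  by apply: (subsetP (sub_ball _ _ _)) xB; rewrite ltnW // ltnS leq_addr.
case: (x \in U' :&: W) => //=.
set a := induced e _; set a' := induced e' _.
have ae : subrel a e by move=> y z /and3P[].
have aa' y : y \in ball e (i + k) X -> forall z, a y z = a' y z.
  move=> yB z; rewrite /a /a' /induced /= -ee' //.
  have [yz|_] := boolP (e y z); last by rewrite !andbF.
  by rewrite (UW _ (sB _ yB)) (UW _ (ballS yB yz)).
have [sm|/norP[]] := boolP ((#|cc a x| <= k) || (#|cc a' x| <= k)); last first.
  by move=> /negbTE -> /negbTE ->.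
have ccE := cc_local ae aa' xB sm; rewrite -ccE in sm *.
rewrite orbb in sm; rewrite sm /=; congr (_ * _ <= _); apply: eq_card => p.
rewrite [LHS]inE [RHS]inE; have [p1|//] := boolP (p.1 \in _).
have p1B := subsetP (small_cc_ball ae (fun _ _ _ => erefl) xB sm) _ p1.
rewrite -ee' //=; have [ep|_] := boolP (e _ _); last by rewrite !andbF.
by rewrite !in_setD UU' // (ballS p1B).
Qed.

(** Each round costs radius [k.+2]: [k.+1] to decide whether a vertex is carved, and one because
    this is asked of both ends of an edge. *)
Lemma kept_local ws i (U U' : {set V}) :
  (forall x, x \in ball e (i + k.+2 * size ws) X -> (x \in U) = (x \in U')) ->
  (forall x, x \in ball e (i + k.+2 * size ws) X -> forall y, e x y = e' x y) ->
  forall x, x \in ball e i X -> forall y, kept k q e U ws x y = kept k q e' U' ws x y.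
Proof.
elim: ws U U' => //= W ws IH U U' UU' ee' x xB y.
set j := i + k.+2 * size ws.
have jE : i + k.+2 * (size ws).+1 = (j.+1 + k).+1 by rewrite /j mulnS; lia.
rewrite jE in UU' ee'.
have DD' z : z \in ball e j.+1 X -> (z \in carved k q e U W) = (z \in carved k q e' U' W).
  by apply: carved_local => // w wB; apply: ee'; apply: subsetP wB; apply: sub_ball.
have sB m : m <= (j.+1 + k).+1 -> {subset ball e m X <= ball e (j.+1 + k).+1 X}.
  by move=> mj; apply/subsetP/sub_ball.
have xj : x \in ball e j.+1 X.
  by apply: subsetP xB; apply: sub_ball; rewrite /j -addnS leq_addr.
congr orb; last first.
  apply: IH => // z zB; last by apply: ee'; apply: sB zB; lia.
  rewrite !in_setD DD' ?UU' //; last by apply: subsetP zB; apply: sub_ball.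
  by apply: sB zB; lia.
rewrite DD' // -ee'; last by apply: sB xj; lia.
have [xy|_] := boolP (e x y); last by rewrite !andbF.
rewrite DD' //; apply: (subsetP (sub_ball _ _ _)) (ballS xB xy).
by rewrite ltnS leq_addr.
Qed.

End Locality.

(** * Matching parts of the same type *)

Section Codings.
Variables (V : finType) (k : nat).
Implicit Types (r : rel V) (C : {set V}).

(* The copies of (C, r) with vertices in ['I_k]: an isomorphism invariant that
   determines (C, r) once it is nonempty, that is when C has at most k elements. *)
Definition codings r C : {set {set 'I_k} * {set 'I_k * 'I_k}} :=
  [set (g @: C, [set (g p.1, g p.2) | p in [set p in setX C C | r p.1 p.2]])
    | g : {ffun V -> 'I_k} in [set g : {ffun V -> 'I_k} | dinjectiveb g C]].

Lemma codings_neq0 r C : 0 < k -> #|C| <= k -> codings r C != set0.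
Proof.
move=> k0 Ck; apply/set0Pn.
pose g := [ffun u => insubd (Ordinal k0) (index u (enum C))].
exists (g @: C, [set (g p.1, g p.2) | p in [set p in setX C C | r p.1 p.2]]).
apply/imsetP; exists g => //; rewrite inE; apply/dinjectiveP => u w uC wC.
have idx v : v \in C -> index v (enum C) < k.
  by move=> vC; apply: leq_trans Ck; rewrite cardE index_mem mem_enum.
move/(congr1 val); rewrite !ffunE /= !insubdK ?idx -?topredE /= ?idx //.
by move=> /(congr1 (nth u (enum C))); rewrite !nth_index ?mem_enum.
Qed.

(** A common coding names the vertices of both sides by the same elements of ['I_k]; the map [h]
    goes from a vertex to its name under [g] and back through [g']. *)
Lemma codings_eq r r' C C' : 0 < k -> #|C| <= k -> codings r C = codings r' C' ->
  exists h : V -> V, [/\ {in C &, injective h}, h @: C = C' &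
    {in C &, forall u w, r u w -> r' (h u) (h w)}].
Proof.
move=> k0 Ck E; have /set0Pn[m mC] := codings_neq0 r k0 Ck.
move: (mC); rewrite E => /imsetP[g']; rewrite inE => /dinjectiveP ig' m'E.
case/imsetP: mC => g; rewrite inE => /dinjectiveP ig mE.
move: mE; rewrite m'E => -[gC gr].
have ex u : u \in C -> exists2 u', u' \in C' & g' u' = g u.
  move=> uC; have: g u \in g' @: C' by rewrite gC; apply: imset_f.
  by case/imsetP => u' ? ->; exists u'.
pose h u := odflt u [pick u' in C' | g' u' == g u].
have hP u : u \in C -> h u \in C' /\ g' (h u) = g u.
  move=> uC; rewrite /h; case: pickP => [u' /andP[? /eqP]//|nh].
  by have [u' u'C gu] := ex u uC; have:= nh u'; rewrite u'C gu eqxx.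
exists h; split.
- move=> u w uC wC huw; apply: ig => //.
  by rewrite -(hP u uC).2 -(hP w wC).2 huw.
- apply/eqP; rewrite eqEsubset; apply/andP; split; apply/subsetP => x.
    by case/imsetP => u uC ->; case: (hP u uC).
  move=> xC; have: g' x \in g @: C by rewrite -gC imset_f.
  case/imsetP => u uC gx; apply/imsetP; exists u => //.
  by case: (hP u uC) => hC gh; apply: ig' => //; rewrite gh gx.
- move=> u w uC wC ruw.
  have: (g u, g w) \in [set (g p.1, g p.2) | p in [set p in setX C C | r p.1 p.2]].
    by apply/imsetP; exists (u, w) => //; rewrite !inE uC wC.
  rewrite -gr => /imsetP[[x y]]; rewrite !inE /= => /andP[/andP[xC yC] rxy] [gx gy].
  have [huC hu] := hP u uC; have [hwC hw] := hP w wC.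
  have -> : h u = x by apply: ig' => //; rewrite hu.
  by have -> : h w = y by apply: ig' => //; rewrite hw.
Qed.

Lemma codings_local r r' C : (forall u, u \in C -> forall w, r u w = r' u w) ->
  codings r C = codings r' C.
Proof.
move=> rr'; have E : [set p in setX C C | r p.1 p.2] = [set p in setX C C | r' p.1 p.2].
  apply/setP => p; rewrite !inE; case: (boolP (p.1 \in C)) => // p1.
  by rewrite rr'.
by rewrite /codings E.
Qed.

End Codings.

(** The complements of [B] and of [h @: B] have the same size, so their enumerations can be matched
    position by position. *)
Lemma extend_injection (V : finType) (B : {set V}) (h : V -> V) :
  {in B &, injective h} -> exists2 g : V -> V, injective g & {in B, g =1 h}.
Proof.
move=> ih; pose Z := enum (~: B); pose Z' := enum (~: (h @: B)).
have sz : size Z = size Z'.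
  rewrite -!cardE; apply: (@addnI #|B|).
  by rewrite cardsC -{1}(card_in_imset ih) cardsC.
pose g x := if x \in B then h x else nth x Z' (index x Z).
have ZP x : x \notin B -> index x Z < size Z'.
  by move=> xB; rewrite -sz index_mem mem_enum inE.
have gZ x : x \notin B -> g x \notin h @: B.
  move=> xB; have: g x \in Z' by rewrite /g (negbTE xB) mem_nth // ZP.
  by rewrite mem_enum inE.
exists g => [x y|x xB]; last by rewrite /g xB.
have [xB|xB] := boolP (x \in B); have [yB|yB] := boolP (y \in B).
- by rewrite /g xB yB; apply: ih.
- by move=> E; move: (gZ y yB); rewrite -E /g xB imset_f.
- by move=> E; move: (gZ x xB); rewrite E /g yB imset_f.
rewrite /g (negbTE xB) (negbTE yB) => E.
move/eqP: E; rewrite (set_nth_default y) ?ZP // nth_uniq ?ZP ?enum_uniq //.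
move=> /eqP /(congr1 (nth x Z)); rewrite !nth_index ?mem_enum ?inE //.
Qed.

Section Matching.
Variables (V : finType) (k : nat) (r r' : rel V).
Hypotheses (k0 : 0 < k) (r_sym : symmetric r) (r'_sym : symmetric r').
Hypotheses (rk : forall v, #|cc r v| <= k).

Let shape v := codings k r (cc r v).
Let shape' v := codings k r' (cc r' v).

(** The closure conditions make [B] and [h @: B] unions of components. Finite functions are used so
    that a largest such pair exists. *)
Let partial_iso (m : {set V} * {ffun V -> V}) : Prop :=
  let: (B, h) := m in
  [/\ forall u w, u \in B -> r u w -> w \in B,
      forall u w, u \in h @: B -> r' u w -> w \in h @: B,
      {in B &, injective h},
      forall u w, u \in B -> r u w -> r' (h u) (h w) &
      forall u, u \in B -> shape' (h u) = shape u].

(** The components of [u] and [w] are disjoint from [B] and [h @: B], so the map between them given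
    by their common codings can be glued to [h]. *)
Let extend B h u w : partial_iso (B, h) -> u \notin B -> w \notin h @: B ->
  shape' w = shape u -> exists2 m, partial_iso m & #|B| < #|m.1|.
Proof.
move=> [clB clB' ih hr hs] uB wB wu.
set C := cc r u; set C' := cc r' w.
have [i [ii iC ir]] := codings_eq k0 (rk u) (esym wu).
have cl (b : rel V) (S : {set V}) v : symmetric b ->
    (forall x y, x \in S -> b x y -> y \in S) -> v \notin S ->
    cc b v \subset ~: S.
  move=> bs clS vS; apply: cc_min; first by rewrite inE.
  by move=> x y; rewrite !inE => xS bxy; apply: contra xS => /clS; apply; rewrite bs.
have CB := subsetP (cl _ _ _ r_sym clB uB).
have CB' := subsetP (cl _ _ _ r'_sym clB' wB).
pose h' := [ffun x => if x \in C then i x else h x].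
have h'C x : x \in C -> h' x = i x by move=> xC; rewrite ffunE xC.
have h'B x : x \in B -> h' x = h x.
  by move=> xB; rewrite ffunE; case: ifP => // /CB; rewrite inE xB.
have iCC x : x \in C -> i x \in C' by move=> xC; rewrite /C' -iC imset_f.
have h'im : h' @: (C :|: B) = C' :|: h @: B.
  rewrite imsetU; congr (_ :|: _); last by apply: eq_in_imset => x /h'B.
  by rewrite /C' -iC; apply: eq_in_imset => x /h'C.
exists (C :|: B, h') => /=; last first.
  apply: proper_card; apply/properP; split; first exact: subsetUr.
  by exists u => //; rewrite inE mem_cc.
split.
- move=> x y; rewrite !(in_setU _ C) => /orP[xC|xB] xy; last by rewrite (clB x y) ?orbT.
  by rewrite (cc_closed xC xy).
- move=> x y; rewrite h'im in_setU => /orP[xC|xB] xy; rewrite in_setU.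
    by rewrite (cc_closed xC xy).
  by rewrite (clB' x y) ?orbT.
- move=> x y; rewrite !(in_setU _ C) => /orP[xC|xB] /orP[yC|yB].
  + by rewrite !h'C //; apply: ii.
  + rewrite h'C // h'B // => E; have := CB' _ (iCC _ xC).
    by rewrite E inE imset_f.
  + rewrite h'B // h'C // => E; have := CB' _ (iCC _ yC).
    by rewrite -E inE imset_f.
  + by rewrite !h'B //; apply: ih.
- move=> x y; rewrite (in_setU _ C) => /orP[xC|xB] xy.
    by have yC := cc_closed xC xy; rewrite !h'C //; apply: ir.
  by have yB := clB _ _ xB xy; rewrite !h'B //; apply: hr.
- move=> x; rewrite (in_setU _ C) => /orP[xC|xB].
    rewrite h'C // /shape' (cc_eq r'_sym (iCC _ xC)) -/(shape' w) wu.
    by rewrite /shape (cc_eq r_sym xC).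
  by rewrite h'B // hs.
Qed.

(** Take a partial isomorphism with [B] largest. If some vertex of shape [s] is unmatched, then by
    maximality every vertex of shape [s] on the other side is already used, so the unmatched ones
    number at most the difference of the two counts. *)
Lemma matching : exists (B : {set V}) (h : V -> V),
  [/\ injective h,
      forall u w, u \in B -> r u w -> r' (h u) (h w) &
      #|~: B| <= \sum_s (#|[set v | shape v == s]| - #|[set v | shape' v == s]|)].
Proof.
pose isob m := `[< partial_iso m >].
have iso0 : isob (set0, [ffun v => v]).
  by apply/asboolP; split=> [u w|u w|u w|u w|u]; rewrite ?imset0 inE.
case: (arg_maxnP (fun m : {set V} * {ffun V -> V} => #|m.1|) iso0) => -[B h] /asboolP iso Bmax.
have [clB clB' ih hr hs] := iso.
have [g ig gh] := extend_injection ih.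
exists B, g; split=> // [u w uB uw|]; first by rewrite !gh ?(clB u w) ?hr.
rewrite -sum1_card (partition_big shape predT) //=; apply: leq_sum => s _.
rewrite sum1dep_card.
have [/existsP[u /andP[uB us]]|nu] := boolP [exists u, (u \in ~: B) && (shape u == s)]; last first.
  rewrite (_ : [set _ | _] = set0) ?cards0 //; apply/setP => u; rewrite [LHS]inE [RHS]inE.
  by apply: contraNF nu => us; apply/existsP; exists u.
have sub' : [set v | shape' v == s] \subset h @: [set v in B | shape v == s].
  apply/subsetP => w; rewrite inE => /eqP ws.
  have [/imsetP[v vB wv]|wB] := boolP (w \in h @: B).
    by rewrite wv imset_f // inE vB -hs // -wv ws /=.
  rewrite inE in uB; have [|m /asboolP/Bmax] := extend iso uB wB; first by rewrite ws (eqP us).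
  by rewrite /= leqNgt => /negbTE ->.
have le' := leq_trans (subset_leq_card sub') (leq_imset_card _ _).
rewrite leq_subRL; last first.
  apply: leq_trans le' _; apply: subset_leq_card; apply/subsetP => v.
  by rewrite !inE => /andP[].
rewrite -(cardsID B [set v | shape v == s]); apply: leq_add.
  apply: leq_trans le' _; apply: subset_leq_card; apply/subsetP => v.
  by rewrite !inE andbC.
apply: subset_leq_card; apply/subsetP => v.
by rewrite !inE.
Qed.

End Matching.

(** * Sampling *)

Section Sampling.
Local Open Scope ring_scope.
Variables (R : realFieldType) (V Z : finType) (Y : V -> Z).

Definition freq z : R := #|[set v | Y v == z]|%:R / #|V|%:R.

Definition representative (eta : R) (t : seq V) : bool :=
  [forall z, `|(count (fun v => Y v == z) t)%:R - (size t)%:R * freq z| <= eta * (size t)%:R].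

Hypothesis V0 : (0 < #|V|)%N.

Let sum_cst (c : R) : \sum_(v : V) c = #|V|%:R * c.
Proof. by rewrite sumr_const mulr_natl. Qed.

(** Additivity of variance for independent centered variables: the mixed terms vanish. *)
Lemma sum_sqr_tuple (g : V -> R) s : \sum_v g v = 0 ->
  #|V|%:R * \sum_(t : s.-tuple V) (\sum_(v <- t) g v) ^+ 2
    = s%:R * #|V|%:R ^+ s * \sum_v g v ^+ 2.
Proof.
move=> g0; elim: s => [|s IH].
  rewrite !mul0r big1 ?mulr0 // => t _.
  by rewrite tuple0 big_nil expr0n.
rewrite (big_tupleS _ (fun t => (\sum_(v <- t) g v) ^+ 2)) /=.
have E x : \sum_(t : s.-tuple V) (\sum_(v <- x :: t) g v) ^+ 2
   = #|V|%:R ^+ s * g x ^+ 2 + 2 * g x * (\sum_(t : s.-tuple V) \sum_(v <- t) g v)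
     + \sum_(t : s.-tuple V) (\sum_(v <- t) g v) ^+ 2.
  rewrite mulr_sumr -natrX -card_tuple mulr_natl -sumr_const -!big_split /=.
  by apply: eq_bigr => t _; rewrite big_cons; ring.
rewrite (eq_bigr _ (fun x _ => E x)) !big_split /= -mulr_sumr -mulr_suml -mulr_sumr g0.
rewrite sum_cst mulr0 mul0r addr0 mulrDr IH.
by rewrite -natr1 exprS; ring.
Qed.

(** Chebyshev's inequality, applied to the sum of the squared deviations over all [z]. The
    frequencies sum to 1, so the total variance is at most [s] and no factor [#|Z|] arises. *)
Lemma card_unrepresentative (eta : R) s : 0 < eta -> (0 < s)%N ->
  #|[set t : s.-tuple V | ~~ representative eta t]|%:R * (eta ^+ 2 * s%:R)
    <= #|V|%:R ^+ s.
Proof.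
move=> eta0 s0; set n : R := #|V|%:R.
have n0 : 0 < n by rewrite ltr0n.
pose g z v : R := (Y v == z)%:R - freq z.
have cE z : \sum_v (Y v == z)%:R = freq z * n :> R.
  by rewrite /freq divfK ?gt_eqF // -natr_sum -big_mkcond -sum1dep_card.
have g0 z : \sum_v g z v = 0.
  by rewrite sumrB cE sum_cst mulrC subrr.
have gG z (t : seq V) : \sum_(v <- t) g z v
    = (count (fun v => Y v == z) t)%:R - (size t)%:R * freq z.
  elim: t => [|x l IH].
    by rewrite big_nil mul0r subrr.
  by rewrite big_cons IH /= natrD -[(size l).+1%:R]natr1 /g; ring.
have g2 z : \sum_v g z v ^+ 2 <= freq z * n.
  rewrite -cE -subr_ge0 -sumrB.
  have -> : \sum_v ((Y v == z)%:R - g z v ^+ 2) = \sum_v (2 * freq z * (Y v == z)%:R - freq z ^+ 2).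
    apply: eq_bigr => v _; rewrite /g; case: (Y v == z) => /=; ring.
  rewrite sumrB -mulr_sumr cE sum_cst -/n.
  rewrite (_ : _ - _ = freq z ^+ 2 * n); last by ring.
  by rewrite mulr_ge0 ?sqr_ge0 ?ltW.
have fr1 : \sum_z freq z * n = n.
  rewrite -(eq_bigr _ (fun z _ => cE z)) exchange_big /= (eq_bigr (fun=> 1)) ?sumr_const // => v _.
  by rewrite (bigD1 (Y v)) //= eqxx big1 ?addr0 // => z /negbTE; rewrite eq_sym => ->.
have tot : \sum_(t : s.-tuple V) \sum_z (\sum_(v <- t) g z v) ^+ 2 <= s%:R * n ^+ s.
  rewrite exchange_big /= -(ler_pM2l n0) mulr_sumr.
  under eq_bigr do rewrite sum_sqr_tuple //.
  have c0 : 0 <= s%:R * n ^+ s by rewrite mulr_ge0 ?exprn_ge0 // ltW.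
  rewrite -mulr_sumr mulrC ler_wpM2r // -fr1.
  exact: ler_sum.
have s0R : 0 < s%:R :> R by rewrite ltr0n.
rewrite -(ler_pM2l s0R) (le_trans _ tot) //.
rewrite (bigID (mem [set t : s.-tuple V | ~~ representative eta t])) /=.
rewrite ler_wpDr ?sumr_ge0 // => [t _|].
  by rewrite sumr_ge0 // => z _; apply: sqr_ge0.
rewrite (_ : s%:R * _ = \sum_(t in [set t : s.-tuple V | ~~ representative eta t]) (eta * s%:R) ^+ 2); last first.
  rewrite sumr_const -[RHS]mulr_natl; ring.
apply: ler_sum => t; rewrite inE => /forallPn[z]; rewrite -ltNge size_tuple => /ltW far_z.
rewrite (bigD1 z) //= ler_wpDr ?sumr_ge0 // => [z' _|]; first exact: sqr_ge0.
by rewrite gG size_tuple -[leRHS]real_normK ?num_real // lerXn2r ?nnegrE ?normr_ge0 //; apply: mulr_ge0 => //; apply: ltW.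
Qed.

End Sampling.

(** * Exploring balls with queries *)

Section Exploration.
Variables (d n : nat).
Implicit Types (f g : oracle d n) (X : {set 'I_n}).

Definition out_neighbors f : rel 'I_n := fun u w => [exists i, f (u, i) == Some w].

Definition patch (l : seq ('I_n * 'I_d)) f g : oracle d n :=
  [ffun y => if y \in l then f y else g y].

Fixpoint ask (l : seq ('I_n * 'I_d)) g (K : oracle d n -> algorithm d n) :
    algorithm d n :=
  if l is y :: l' then
    Query y.1 y.2 (fun a => ask l' [ffun z => if z == y then a else g z] K)
  else K g.

Lemma prob_ask (R : realType) l g K f b :
  prob_verdict R b f (ask l g K) = prob_verdict R b f (K (patch l f g)).
Proof.
elim: l g => [|[v i] l IH] g /=.
  by congr (prob_verdict _ _ _ (K _)); apply/ffunP => y; rewrite ffunE.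
rewrite IH; congr (prob_verdict _ _ _ (K _)); apply/ffunP => y; rewrite !ffunE inE.
by case: eqP => [->|_] /=; case: ifP.
Qed.

Lemma queries_ask l g K f :
  queries f (ask l g K) = size l + queries f (K (patch l f g)).
Proof.
elim: l g => [|[v i] l IH] g /=.
  by rewrite add0n; congr (queries _ (K _)); apply/ffunP => y; rewrite ffunE.
rewrite IH addSn; congr (_ + queries _ (K _)).+1; apply/ffunP => y; rewrite !ffunE inE.
by case: eqP => [->|_] /=; case: ifP.
Qed.

Definition slots X : seq ('I_n * 'I_d) := enum (setX X [set: 'I_d]).

Lemma mem_slots X u i : ((u, i) \in slots X) = (u \in X).
Proof. by rewrite mem_enum !inE andbT. Qed.

Lemma size_slots X : size (slots X) = d * #|X|.
Proof. by rewrite -cardE cardsX cardsT card_ord mulnC. Qed.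

(** Unasked slots hold the default [None], which also stands for a missing neighbor; only slots of
    vertices in [X] may be trusted. *)
Definition restrict f X := patch (slots X) f [ffun=> None].

Lemma restrictE f X u i : u \in X -> restrict f X (u, i) = f (u, i).
Proof. by move=> uX; rewrite ffunE mem_slots uX. Qed.

Definition grow f X := X :|: \bigcup_(u in X) [set w | out_neighbors f u w].

(** Every round asks the whole current set afresh, so that the last answers alone describe the
    entire ball. *)
Fixpoint explore j X (K : {set 'I_n} -> oracle d n -> algorithm d n) : algorithm d n :=
  ask (slots X) [ffun=> None]
    (fun g => if j is j'.+1 then explore j' (grow g X) K else K X g).

Lemma grow_restrict f X : grow (restrict f X) X = grow f X.
Proof.
congr (_ :|: _); apply: eq_bigr => u uX; apply/setP => w; rewrite !inE.
by apply: eq_existsb => i; rewrite restrictE.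
Qed.

Lemma prob_explore (R : realType) j X K f b :
  prob_verdict R b f (explore j X K) =
  let B := ball (out_neighbors f) j X in prob_verdict R b f (K B (restrict f B)).
Proof.
elim: j X => [|j IH] X /=; rewrite prob_ask //.
by rewrite -/(restrict f X) grow_restrict IH -ballSr.
Qed.

Lemma card_grow f X : #|grow f X| <= d.+1 * #|X|.
Proof.
rewrite mulSn; apply: leq_trans (leq_card_setU _ _) _; rewrite leq_add2l.
rewrite -size_slots; set l := slots X.
apply: (@leq_trans #|pmap (fun y => f y) l|); last first.
  by apply: leq_trans (card_size _) _; rewrite size_pmap count_size.
apply: subset_leq_card; apply/subsetP => w /bigcupP[u uX]; rewrite inE => /existsP[i /eqP fu].
by rewrite mem_pmap -fu map_f // mem_slots.
Qed.

(** The explored set grows at most by the factor [d.+1] per step, and each of the [j.+1] rounds is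
    charged the size of the last set. *)
Lemma queries_explore j X K f :
  queries f (explore j X K) <=
  j.+1 * (d * (d.+1 ^ j * #|X|)) +
  let B := ball (out_neighbors f) j X in queries f (K B (restrict f B)).
Proof.
elim: j X => [|j IH] X /=; rewrite queries_ask size_slots.
  by rewrite mul1n expn0 mul1n.
rewrite -/(restrict f X) grow_restrict; apply: leq_trans (leq_add (leqnn _) (IH _)) _.
rewrite -ballSr /= addnA leq_add2r [leqRHS]mulSn.
apply: leq_add; first by rewrite leq_mul2l leq_pmull ?orbT // expn_gt0.
do 2!apply: leq_mul => //; rewrite expnSr -mulnA; apply: leq_mul => //; exact: card_grow.
Qed.

End Exploration.

(** * Partition statistics *)

Section Statistic.
Variables (V : finType) (k q d : nat).
Implicit Types (e : rel V) (ws : seq {set V}).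

Definition label : finType := ({set {set 'I_k} * {set 'I_k * 'I_k}} * 'I_d.+1)%type.

(** The second entry counts the cut edges at [v]; under the degree bound [inord] does not alter
    it. *)
Definition stat e ws v : label :=
  let r := kept k q e setT ws in
  (codings k r (cc r v), inord #|[set w | e v w && ~~ r v w]|).

(** The part of [v] lies within distance [k], and the kept edges at each of its vertices are decided
    within a further [k.+2 * size ws]. *)
Lemma stat_local e e' ws (X : {set V}) : 0 < k -> symmetric e ->
  (forall x, x \in ball e (k + k.+2 * size ws) X -> forall y, e x y = e' x y) ->
  forall v, v \in X -> stat e ws v = stat e' ws v.
Proof.
move=> k0 e_sym ee' v vX.
have rr' x : x \in ball e k X -> forall y, kept k q e setT ws x y = kept k q e' setT ws x y.
  by apply: kept_local => // y _; rewrite !inE.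
rewrite /stat; set r := kept k q e _ _ in rr' *; set r' := kept k q e' _ _ in rr' *.
have re : subrel r e by move=> x y /kept_sub[].
have sm : #|cc r v| <= k by apply: card_cc_kept.
have ccB : cc r v \subset ball e (0 + k) X by apply: (small_cc_ball re).
have ccE : cc r v = cc r' v.
  by apply: (cc_local (i := 0) (k := k) (X := X) re) => //; rewrite sm.
rewrite -ccE (codings_local _ (r' := r')) => [|u uC w]; last first.
  by apply: rr'; apply: (subsetP ccB).
congr (_, inord _); apply: eq_card => w; rewrite [LHS]inE [RHS]inE.
rewrite rr' ?ee' //; apply: (subsetP (sub_ball _ _ (leq0n _))) => //.
Qed.

Lemma sum_stat e ws : (forall v, #|[set u | e v u]| <= d) ->
  \sum_v ((stat e ws v).2 : nat) = #|unkept k q e setT ws|.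
Proof.
move=> edeg; rewrite -sum1_card (partition_big fst predT) //=; apply: eq_bigr => v _.
rewrite inordK; last first.
  rewrite ltnS (leq_trans _ (edeg v)) //; apply: subset_leq_card.
  by apply/subsetP => w; rewrite !inE => /andP[].
rewrite sum1dep_card -(card_imset (f := fun w => (v, w))) => [|x y [] //].
apply: eq_card => -[x w]; rewrite !inE /=; apply/imsetP/idP => [[y]|].
  by rewrite inE => yv [-> ->]; rewrite yv eqxx.
case/andP => xw /eqP <-; exists w => //; by rewrite inE.
Qed.

End Statistic.

(** * Edit distance between graphs with similar statistics *)

Section Graphs.
Variables (d n : nat).
Implicit Types (G H : dgraph d n) (f : oracle d n).

Lemma adj_sym G : symmetric (adj G).
Proof. by move=> u w; rewrite /adj setUC. Qed.

Lemma adj_deg G v : #|[set u | adj G v u]| <= d.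
Proof. by have /andP[_ /forallP] := dgraphP G; apply. Qed.

Lemma card_edge G x : x \in edges G -> #|x| = 2.
Proof. by have /andP[/forall_inP E _] := dgraphP G; move=> /E/eqP. Qed.

Lemma set2_inj (T : finType) (a b x y : T) : [set x; y] = [set a; b] ->
  (x, y) = (a, b) \/ (x, y) = (b, a).
Proof.
move=> E.
have xab : x \in [set a; b] by rewrite -E set21.
have yab : y \in [set a; b] by rewrite -E set22.
have axy : a \in [set x; y] by rewrite E set21.
have bxy : b \in [set x; y] by rewrite E set22.
case/set2P: xab axy bxy => ->; case/set2P: yab => -> axy bxy; auto.
  by case/set2P: bxy => ->; left.
by case/set2P: axy => ->; left.
Qed.

Lemma dgraph_sub G (E : {set {set 'I_n}}) : E \subset edges G -> is_dgraph d E.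
Proof.
move=> EG; apply/andP; split; apply/forallP => v.
  by apply/implyP => /(subsetP EG)/card_edge ->.
apply: leq_trans (adj_deg G v); apply: subset_leq_card; apply/subsetP => u.
by rewrite !inE => /(subsetP EG).
Qed.

Variables (k q : nat).
Hypothesis k0 : 0 < k.
Local Notation stat G ws := (stat k q d (adj G) ws).

(** Here [H] is edited, and [G] has the cheap partition. [H'] retains the kept edges of [H] at
    matched vertices. The deleted edges are cut, or meet unmatched vertices: the former number at
    most the cut count of [G] plus [d * D], the latter at most [d * D]. *)
Lemma edit_bound G H wsG wsH : exists H' : dgraph d n,
  subgraph H' G /\
  edit_distance H H' <=
    \sum_v ((stat G wsG v).2 : nat) +
    2 * d * \sum_z (#|[set v | stat H wsH v == z]| - #|[set v | stat G wsG v == z]|).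
Proof.
set YG := stat G wsG; set YH := stat H wsH; set D := (X in 2 * d * X).
set r := kept k q (adj H) setT wsH; set r' := kept k q (adj G) setT wsG.
have rs : symmetric r by apply: kept_sym; apply: adj_sym.
have rs' : symmetric r' by apply: kept_sym; apply: adj_sym.
have rk v : #|cc r v| <= k by apply: card_cc_kept => //; apply: adj_sym.
have [B [h [ih hr hB]]] := matching k0 rs rs' rk.
pose E' := [set x in edges H | [exists u, exists w, [&& x == [set u; w], r u w & u \in B]]].
have E'H : E' \subset edges H by apply/subsetP => x; rewrite inE => /andP[].
exists (DGraph (dgraph_sub E'H)); split.
  exists h; split => // u w; rewrite {1}/adj /= inE => /andP[_].
  case/existsP => u' /existsP[w' /and3P[/eqP uw ruw uB]].
  have /kept_sub[_ _ G'] := hr _ _ uB ruw.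
  by case: (set2_inj uw) => -[-> ->] //; rewrite adj_sym.
(* Forgetting the cut number merges classes of labels, which can only lower the sum of truncated
   differences. *)
have DB : #|~: B| <= D.
  apply: leq_trans hB _; have -> : D = \sum_s \sum_c
      (#|[set v | YH v == (s, c)]| - #|[set v | YG v == (s, c)]|).
    by rewrite pair_bigA /D /=; apply: eq_bigr => -[s c] _.
  apply: leq_sum => s _; rewrite leq_subLR.
  have fib (Y : 'I_n -> label k d) : #|[set v | (Y v).1 == s]| = \sum_c #|[set v | Y v == (s, c)]|.
    rewrite -sum1dep_card (partition_big (fun v => (Y v).2) predT) //=; apply: eq_bigr => c _.
    by rewrite sum1dep_card; apply: eq_card => v; rewrite !inE; case: (Y v).
  rewrite (fib YH) (fib YG) -big_split /=; apply: leq_sum => c _.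
  by rewrite -leq_subLR.
(* Each vertex counted in the surplus [D] adds at most [d] cut pairs. *)
have sumH : \sum_v ((YH v).2 : nat) <= \sum_v ((YG v).2 : nat) + d * D.
  have fib (Y : 'I_n -> label k d) : \sum_v ((Y v).2 : nat) = \sum_z #|[set v | Y v == z]| * z.2.
    rewrite (partition_big Y predT) //=; apply: eq_bigr => z _.
    by rewrite -sum_nat_const; apply: eq_big => [v|v /eqP -> //]; rewrite inE.
  rewrite (fib YH) (fib YG) /D big_distrr -big_split /=; apply: leq_sum => z _.
  have : z.2 <= d by rewrite -ltnS.
  set a := #|_|; set b := #|_|; set c := nat_of_ord _; move=> cd.
  apply: (@leq_trans ((b + (a - b)) * c)); first by rewrite leq_mul2r -leq_subLR leqnn orbT.
  by rewrite mulnDl leq_add2l mulnC leq_mul2r cd orbT.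
have -> : edit_distance H (DGraph (dgraph_sub E'H)) = #|edges H :\: E'|.
  rewrite /edit_distance /= -[RHS]addn0; congr (_ + _); apply/eqP.
  by rewrite cards_eq0 setD_eq0.
pose Q : {set 'I_n * 'I_n} := [set p | (p.1 \in ~: B) && adj H p.1 p.2].
have HE : #|edges H :\: E'| <= #|unkept k q (adj H) setT wsH :|: Q|.
  apply: leq_trans (leq_imset_card (fun p => [set p.1; p.2]) _); apply: subset_leq_card.
  apply/subsetP => x /setDP[xH xE].
  have /eqP/cards2P[u [w [_ xuw]]] := card_edge xH.
  apply/imsetP; exists (u, w) => //; rewrite inE [_ \in Q]inE !in_set /= -/r.
  have -> : adj H u w by rewrite /adj -xuw.
  apply: contraR xE; rewrite negb_or !andbT !negbK => /andP[ruw uB]; rewrite inE xH.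
  by apply/existsP; exists u; apply/existsP; exists w; rewrite xuw eqxx ruw uB.
apply: leq_trans HE _; apply: leq_trans (leq_card_setU _ _) _.
rewrite -(@sum_stat _ k q d _ wsH (@adj_deg H)).
have := card_pairs_from (adj_deg H) (~: B); rewrite -/Q => QB.
have QD : #|Q| <= d * D by apply: leq_trans QB _; rewrite leq_mul2l DB orbT.
apply: leq_trans (leq_add sumH QD) _.
by rewrite -addnA leq_add2l mul2n -addnn mulnDl.
Qed.

Lemma represents_out G f : represents G f -> out_neighbors f =2 adj G.
Proof.
move=> /forallP Gf u w; have /hasP[s] := Gf u.
rewrite mem_permutations => ps /forallP fs.
have -> : adj G u w = (w \in s).
  by rewrite (perm_mem ps) mem_enum [RHS]inE.
have sd : size s <= d by rewrite (perm_size ps) -cardE; apply: adj_deg.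
apply/existsP/onthP => [[i /eqP fi]|[i si]]; first by exists i; rewrite -fi (eqP (fs i)).
have id : i < d by apply: leq_trans sd; rewrite -onthTE si.
by exists (Ordinal id); rewrite (eqP (fs _)) si.
Qed.

Lemma lost_pairs G (F : {set {set 'I_n}}) :
  #|[set p | adj G p.1 p.2 && ~~ ([set p.1; p.2] \in edges G :\: F)]| <= 2 * #|F|.
Proof.
set Q := [set p | _].
apply: (@leq_trans (\sum_(x in F) #|[set p in Q | [set p.1; p.2] == x]|)).
  rewrite -sum1_card (partition_big (fun p => [set p.1; p.2]) (mem F)) /=.
    by apply: leq_sum => x _; rewrite sum1dep_card.
  by move=> p; rewrite inE => /andP[pG]; rewrite in_setD negb_and negbK => /orP[//|]; rewrite -/(adj G _ _) pG.
rewrite mulnC -sum_nat_const; apply: leq_sum => x _.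
have [->|[[a b]]] := set_0Vmem [set p in Q | [set p.1; p.2] == x]; first by rewrite cards0.
rewrite inE /= => /andP[_ /eqP <-]; apply: leq_trans (_ : #|[set (a, b); (b, a)]| <= _).
  apply: subset_leq_card; apply/subsetP => -[x' y']; rewrite inE => /andP[_ /eqP] /= E.
  by case: (set2_inj E) => ->; rewrite !inE eqxx ?orbT.
by rewrite cards2; case: eqP.
Qed.

End Graphs.

(** * The tester *)

Section Tester.
Local Open Scope ring_scope.
Variable R : realType.

Lemma exists_pow_le (p c : R) : 0 < p <= 1 -> 0 < c -> exists T, (1 - p) ^+ T <= c.
Proof.
move=> /andP[p0 p1] c0; have q0 : 0 <= 1 - p by rewrite subr_ge0.
(* A form of Bernoulli's inequality, bounding the power by [1 / (1 + T * p)]. *)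
have bern T : (1 - p) ^+ T * (1 + T%:R * p) <= 1.
  elim: T => [|T IH]; first by rewrite expr0 mul0r addr0 mul1r.
  apply: le_trans IH; rewrite exprSr -mulrA ler_wpM2l ?exprn_ge0 //.
  have T0 : 0 <= T%:R :> R by rewrite ler0n.
  by rewrite -natr1; nra.
have [T Tc] : exists T : nat, c^-1 / p <= T%:R.
  exists (Num.bound (c^-1 / p)); apply/ltW/archi_boundP.
  by rewrite divr_ge0 ?invr_ge0 // ltW.
exists T; have T1 : c^-1 <= 1 + T%:R * p.
  by move: Tc; rewrite ler_pdivrMr // => Tc; lra.
have := bern T; have q1 : 0 <= (1 - p) ^+ T by rewrite exprn_ge0.
have := ler_wpM2l q1 T1 => le1 le2; have := le_trans le1 le2.
by rewrite ler_pdivrMr // mul1r.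
Qed.

(** Hyperfiniteness yields [k] only once [delta] is fixed, and the number [T] of rounds depends on
    [k]; hence the order of quantifiers. The divisor 6 prepares for Markov's inequality. *)
Lemma expected_unkept d (beta : R) : (0 < d)%N -> 0 < beta ->
  exists (q : nat) (delta : R), 0 < delta /\ forall k, exists T, forall n (G : dgraph d n),
    hyperfinite_graph delta k G ->
    \sum_(ws : T.-tuple {set 'I_n}) #|unkept k q (adj G) setT ws|%:R
      <= (2 ^ n)%:R ^+ T * (beta * n%:R / 6).
Proof.
move=> d0 beta0; have d0R : 0 < d%:R :> R by rewrite ltr0n.
(* The final bound has three terms, each at most [beta * n / 18]: [2 * n / q] from carved boundaries
   fixes [q], [d * b] from the lost edges fixes [delta], and [d * (1 - M^-1) ^+ T * n] from the
   leftover fixes [T]. *)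
have [q q36] : exists q : nat, 36 / beta <= q%:R.
  by exists (Num.bound (36 / beta)); apply/ltW/archi_boundP; rewrite divr_ge0 // ltW.
have q0 : 0 < q%:R :> R by apply: lt_le_trans q36; rewrite divr_gt0.
exists q, (beta / (36 * d%:R * q%:R)); split=> [|k]; first by rewrite divr_gt0 ?mulr_gt0.
pose M : R := (2 ^ (k + d * k))%:R.
have M1 : 1 <= M by rewrite ler1n expn_gt0.
have p01 : 0 < M^-1 <= 1.
  by rewrite invr_gt0 (lt_le_trans ltr01 M1) invf_le1 // (lt_le_trans ltr01 M1).
have [T Tb] := exists_pow_le p01 (divr_gt0 beta0 (mulr_gt0 (ltr0n R 18) d0R)).
exists T => n G [F [FG Fn Fk]].
pose r : rel 'I_n := fun x y => [set x; y] \in edges G :\: F.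
have rs : symmetric r by move=> x y; rewrite /r setUC.
have re : subrel r (adj G) by move=> x y; rewrite /r inE => /andP[].
have := @sum_leftover _ k q d (adj G) (@adj_deg d n G) R r M^-1 _ T setT rs re Fk erefl erefl.
rewrite cardsT card_ord; set b := (_ * _)%:R; set N : R := (2 ^ n)%:R ^+ T => left_le.
have N0 : 0 <= N by rewrite exprn_ge0.
have b0 : 0 <= b by rewrite ler0n.
have n0 : 0 <= n%:R :> R by rewrite ler0n.
have bn : b * d%:R <= beta * n%:R / 18.
  have : b <= q%:R * (2 * (beta / (36 * d%:R * q%:R) * n%:R)).
    rewrite /b natrM ler_wpM2l ?ler0n //; apply: le_trans (ler_wpM2l _ Fn) => //.
    by rewrite -natrM ler_nat; apply: lost_pairs.
  move=> /(ler_wpM2r (ltW d0R)) /le_trans; apply; rewrite le_eqVlt; apply/orP; left; apply/eqP.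
  by field; rewrite !gt_eqF.
have un_le : q%:R * \sum_(ws : T.-tuple {set 'I_n}) #|unkept k q (adj G) setT ws|%:R
    <= q%:R * (2 / q%:R * n%:R * N + d%:R * \sum_(ws : T.-tuple {set 'I_n}) #|leftover k q (adj G) setT ws|%:R).
  have -> : 2 / q%:R * n%:R * N = \sum_(ws : T.-tuple {set 'I_n}) 2 / q%:R * n%:R.
    rewrite sumr_const card_tuple -cardsT -powersetT card_powerset cardsT card_ord.
    by rewrite -[RHS]mulr_natr natrX.
  rewrite [d%:R * _]mulr_sumr -big_split /= !mulr_sumr; apply: ler_sum => ws _.
  have := card_unkept k q (@adj_sym d n G) (@adj_deg d n G) setT ws.
  rewrite -(ler_nat R) natrD !natrM cardsT card_ord => /le_trans; apply.
  rewrite mulrDr !mulrA lerD2r le_eqVlt; apply/orP; left; apply/eqP.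
  by field; rewrite gt_eqF.
rewrite ler_pM2l // in un_le; apply: le_trans un_le _.
have q2 : 2 / q%:R <= beta / 18.
  rewrite ler_pdivrMr //; rewrite ler_pdivrMr // in q36; lra.
have dT : d%:R * (1 - M^-1) ^+ T <= beta / 18.
  rewrite mulrC -ler_pdivlMr //; apply: le_trans Tb _.
  by rewrite le_eqVlt; apply/orP; left; apply/eqP; field; rewrite gt_eqF.
have left_le' := ler_wpM2l (ltW d0R) left_le.
apply: le_trans (lerD (lexx _) left_le') _.
set x := (1 - M^-1) ^+ T in dT *; have x0 : 0 <= x.
  by rewrite exprn_ge0 // subr_ge0; case/andP: p01.
rewrite [d%:R * _]mulrCA [_ * N]mulrC -mulrDr ler_wpM2l //.
have h1 : 2 / q%:R * n%:R <= beta / 18 * n%:R by rewrite ler_wpM2r.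
have h2 : d%:R * x * n%:R <= beta / 18 * n%:R by rewrite ler_wpM2r.
have h3 : 0 <= d%:R * x * b by rewrite !mulr_ge0 // ltW.
by lra.
Qed.

Section SampledExploration.
Variables (d n : nat) (O : finType) (o0 : O) (X : O -> {set 'I_n}).
Variables (K : O -> {set 'I_n} -> oracle d n -> bool) (r : nat).

(** A uniform element of [O] is drawn as a position in [enum O]; the default [o0] is never reached,
    and makes [O] nonempty so that [#|O|.-1.+1] is its size. *)
Definition sampled_exploration : algorithm d n :=
  Sample (fun x : 'I_(#|O|.-1).+1 =>
    let o := nth o0 (enum O) x in explore r (X o) (fun B g => Halt d n (K o B g))).

Lemma queries_sampled_exploration m f : (forall o, #|X o| <= m)%N ->
  (queries f sampled_exploration <= r.+1 * (d * (d.+1 ^ r * m)))%N.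
Proof.
move=> Xm /=; apply/bigmax_leqP => x _; apply: leq_trans (queries_explore _ _ _ _) _.
by rewrite /= addn0; do 3!apply: leq_mul => //.
Qed.

Lemma prob_sampled_exploration (f : oracle d n) b :
  let dec o := let B := ball (out_neighbors f) r (X o) in K o B (restrict f B) in
  prob_verdict R b f sampled_exploration = #|[set o | dec o == b]|%:R / #|O|%:R.
Proof.
move=> dec /=; have O0 : (0 < #|O|)%N by apply/card_gt0P; exists o0.
congr (_ / _); last by rewrite prednK.
pose F o := prob_verdict R b f (explore r (X o) (fun B g => Halt d n (K o B g))).
rewrite -(big_mkord predT (fun x => F (nth o0 (enum O) x))) prednK // cardE.
rewrite -(big_nth o0 predT F) big_enum /= -sum1dep_card natr_sum [RHS]big_mkcond /=.
by apply: eq_bigr => o _; rewrite /F prob_explore /= -/(dec o); case: (_ == b).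
Qed.

End SampledExploration.

End Tester.

(** * Correctness of the tester *)

Section Frequencies.
Local Open Scope ring_scope.

Lemma natr_card_pairs (R : realFieldType) (A B : finType) (Q : A -> B -> bool) :
  #|[set o : A * B | Q o.1 o.2]|%:R = \sum_a #|[set b | Q a b]|%:R :> R.
Proof.
rewrite -sum1dep_card big_mkcond /= -(pair_bigA _ (fun a b => if Q a b then 1%N else 0%N)) /=.
rewrite natr_sum; apply: eq_bigr => a _; rewrite -sum1dep_card; congr _%:R.
by rewrite [RHS]big_mkcond.
Qed.

Lemma edit_bound_freq (R : realType) d n k q (G H : dgraph d n) wsG wsH (c eta : R) :
  (0 < k)%N -> (0 < n)%N ->
  let YG := stat k q d (adj G) wsG in let YH := stat k q d (adj H) wsH in
  (\sum_v ((YG v).2 : nat))%:R <= c ->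
  (forall z, `|freq R YH z - freq R YG z| <= eta) ->
  exists H' : dgraph d n, subgraph H' G /\
    (edit_distance H H')%:R <= c + 2 * d%:R * (#|{: label k d}|%:R * (eta * n%:R)).
Proof.
move=> k0 n0 YG YH cG close; have n0R : 0 < n%:R :> R by rewrite ltr0n.
have [H' [sub edit]] := edit_bound q k0 G H wsG wsH; exists H'; split=> //.
rewrite -(ler_nat R) in edit; apply: le_trans edit _; rewrite natrD !natrM.
apply: lerD => //; apply: ler_wpM2l; [exact: mulr_ge0|rewrite natr_sum].
rewrite mulr_natl -sumr_const; apply: ler_sum => z _.
have := close z; rewrite /freq card_ord -mulrBl normrM normfV (gtr0_norm n0R) ler_pdivrMr //.
rewrite -/YG -/YH; set a := #|_|; set b := #|_| => ab.
have [ab'|ba] := leqP a b.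
  by move: ab'; rewrite -subn_eq0 => /eqP ->; apply: le_trans ab; apply: normr_ge0.
by rewrite natrB ?(ltnW ba) //; apply: le_trans ab; apply: ler_norm.
Qed.

End Frequencies.

Theorem theorem2 (R : realType) (d : nat) (P : graph_family d)
    (hd : 0 < d) (hP : graph_property P) (hmon : monotone_property P)
    (hfin : hyperfinite_family R P) : testable R P.
Proof.
Local Open Scope ring_scope.
move=> eps eps0; have d0 : 0 < d%:R :> R by rewrite ltr0n.
(* The cut edges and, with [eta] below, the mismatched labels will each account for
   [eps * d * n / 4] edits, half of the allowance in total. *)
pose beta := eps * d%:R / 4; have beta0 : 0 < beta by rewrite divr_gt0 ?mulr_gt0.
have [q [delta [delta0 hT]]] := expected_unkept hd beta0.
have [k' hk'] := hfin delta delta0; set k := k'.+1.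
have [T HT] := hT k.
have hk n (G : dgraph d n) : P n G -> hyperfinite_graph delta k G.
  move=> /hk'[F [FG Fn Fk]]; exists F; split=> // v.
  exact: leq_trans (Fk v) (leqnSn _).
pose zn : R := #|{: label k d}|%:R.
have zn0 : 0 < zn by rewrite ltr0n; apply/card_gt0P; exists (set0, ord0).
pose eta := eps / (16 * zn); have eta0 : 0 < eta by rewrite divr_gt0 ?mulr_gt0.
(* This makes a sample unrepresentative with probability at most 1/6. *)
have [s [s0 s6]] : exists s : nat, (0 < s)%N /\ 6 <= eta ^+ 2 * s%:R.
  have e2 : 0 < eta ^+ 2 by rewrite exprn_gt0.
  have := archi_boundP (ltW (divr_gt0 (ltr0n R 6) e2)); set s := Num.bound _ => sb.
  exists s; split; last by rewrite mulrC -ler_pdivrMr // ltW.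
  by rewrite -(ltr0n R); apply: lt_trans sb; rewrite divr_gt0.
pose rad := (k + k.+2 * T)%N.
(* Only queries are charged, so all members of [P] on [n] vertices may be searched. The graph [G]
   enters only through the statistic at the sampled vertices. *)
pose accepted n (G : dgraph d n) (ws : T.-tuple {set 'I_n}) (t : s.-tuple 'I_n) : Prop :=
  exists (G0 : dgraph d n) (ws0 : T.-tuple {set 'I_n}),
    [/\ P n G0, (\sum_v ((stat k q d (adj G0) ws0 v).2 : nat))%:R <= beta * n%:R &
      forall z, `|(count (fun v => stat k q d (adj G) ws v == z) t)%:R
                  - s%:R * freq R (stat k q d (adj G0) ws0) z| <= eta * s%:R].
pose O n : finType := (T.-tuple {set 'I_n} * s.-tuple 'I_n)%type.
(* Any graph consistent with the answers will do, as acceptance is local. *)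
pose verdict n (o : O n) (B : {set 'I_n}) (g : oracle d n) : bool :=
  `[< exists (G' : dgraph d n) (f' : oracle d n), [/\ represents G' f',
        forall u i, u \in B -> f' (u, i) = g (u, i) & accepted n G' o.1 o.2] >].
pose tester n : algorithm d n :=
  match n with
  | 0 => Halt d 0 true
  | n'.+1 => sampled_exploration (nseq_tuple T set0, nseq_tuple s ord0)
      (fun o : O n'.+1 => [set v in o.2]) (@verdict n'.+1) rad
  end.
exists (rad.+1 * (d * (d.+1 ^ rad * s))).+1, tester; split; last first.
  case=> [|n]; rewrite ltnS.
    by apply/bigmax_leqP => G _; apply/bigmax_leqP => f _.
  apply/bigmax_leqP => G _; apply/bigmax_leqP => f _; apply: queries_sampled_exploration => o.
  by rewrite cardsE; apply: leq_trans (card_size _) _; rewrite size_tuple.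
case=> // n' G f _ Gf; set n := n'.+1 in G f Gf *.
have n0 : 0 < n%:R :> R by rewrite ltr0n.
have V0 : (0 < #|'I_n|)%N by rewrite card_ord.
pose N : R := (2 ^ n)%:R ^+ T.
have N0 : 0 < N by rewrite exprn_gt0 // ltr0n expn_gt0.
have ns0 : 0 < n%:R ^+ s :> R by rewrite exprn_gt0.
have cardT : #|{: T.-tuple {set 'I_n}}|%:R = N.
  by rewrite card_tuple -cardsT -powersetT card_powerset cardsT card_ord natrX.
have cardS : #|{: s.-tuple 'I_n}|%:R = n%:R ^+ s :> R by rewrite card_tuple card_ord natrX.
have cardO : #|O n|%:R = N * n%:R ^+ s by rewrite card_prod natrM cardT cardS.
have verdictE (o : O n) : let B := ball (out_neighbors f) rad [set v in o.2] in
    verdict n o B (restrict f B) = `[< accepted n G o.1 o.2 >].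
  (* A consistent [G'] has the same edges as [G] at every vertex of the explored ball, hence by
     [stat_local] the same statistic on the sample. *)
  move=> B; apply/asbool_equiv_eq; split => [[G' [f' [Gf' ff' [G0 [ws0 [PG0 cG0 close]]]]]]|acc].
    exists G0, ws0; split; [exact: PG0|exact: cG0|move=> z].
    rewrite (_ : count _ _ = count (fun v => stat k q d (adj G') o.1 v == z) o.2); first exact: close.
    apply: eq_in_count => v vo; congr (_ == z).
    apply: (@stat_local _ k q d _ _ _ [set v in o.2]); rewrite ?inE //; first exact: adj_sym.
    move=> x; rewrite size_tuple => xB y.
    rewrite -(represents_out Gf) -(represents_out Gf').
    have {}xB : x \in B by rewrite /B (eq_ball _ _ (represents_out Gf)).
    by apply: eq_existsb => i; rewrite ff' ?restrictE.
  exists G, f; split; [exact: Gf|move=> u i uB; by rewrite restrictE|exact: acc].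
have probE b : prob_verdict R b f (tester n) =
    #|[set o : O n | `[< accepted n G o.1 o.2 >] == b]|%:R / (N * n%:R ^+ s).
  rewrite -cardO prob_sampled_exploration; congr (_%:R / _); apply: eq_card => o.
  by rewrite !inE -verdictE.
have unrep (ws : T.-tuple {set 'I_n}) :
    #|[set t : s.-tuple 'I_n | ~~ representative (stat k q d (adj G) ws) eta t]|%:R <= n%:R ^+ s / 6 :> R.
  rewrite ler_pdivlMr //.
  apply: le_trans (ler_wpM2l (ler0n _ _) s6) _.
  by have := card_unrepresentative (stat k q d (adj G) ws) V0 eta0 s0; rewrite card_ord.
have rep_close ws (t : s.-tuple 'I_n) z : representative (stat k q d (adj G) ws) eta t ->
    `|(count (fun v => stat k q d (adj G) ws v == z) t)%:R
        - s%:R * freq R (stat k q d (adj G) ws) z| <= eta * s%:R.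
  by move=> /forallP/(_ z); rewrite size_tuple.
split=> [PG|Gfar]; last first.
  (* For any sets [ws], a far graph can be accepted only on unrepresentative samples. *)
  have le6 : #|[set o : O n | `[< accepted n G o.1 o.2 >] ]|%:R <= N * n%:R ^+ s / 6.
    rewrite (natr_card_pairs _ (fun ws t => `[< accepted n G ws t >])).
    rewrite -cardT -mulrA mulr_natl -sumr_const; apply: ler_sum => ws _.
    apply: le_trans (unrep ws); rewrite ler_nat; apply: subset_leq_card.
    apply/subsetP => t; rewrite !inE => /asboolP[G0 [ws0 [PG0 cG0 close]]].
    apply/negP => rep.
    (* One [eta] is the sampling error and the other the tolerance of the acceptance test.
       Monotonicity then puts [H'] in [P], too close to [G]. *)
    have [z|H' [sub edit]] := edit_bound_freq (H := G) (wsH := ws) (eta := 2 * eta) (ltn0Sn k') (ltn0Sn n') cG0.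
      have s0R : 0 < s%:R :> R by rewrite ltr0n.
      rewrite -(ler_pM2l s0R) -{1}(gtr0_norm s0R) -normrM mulrBr.
      have -> : s%:R * (2 * eta) = eta * s%:R + eta * s%:R by ring.
      apply: le_trans (ler_distD _ _ _) (lerD _ (close z)).
      by rewrite distrC; apply: rep_close rep.
    have := Gfar H' (hmon _ _ _ _ sub PG0); apply/negP; rewrite -ltNge.
    apply: le_lt_trans edit _; rewrite -/zn -/n /eta /beta.
    have -> : eps * d%:R / 4 * n%:R + 2 * d%:R * (zn * (2 * (eps / (16 * zn)) * n%:R))
      = eps * d%:R * n%:R / 2 by field; rewrite gt_eqF.
    by rewrite ltr_pdivrMr // ltr_pMr ?mulr_gt0 // ltr1n.
  rewrite probE ler_pdivlMr ?mulr_gt0 //.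
  have := cardsC [set o : O n | `[< accepted n G o.1 o.2 >] ].
  move/(congr1 (fun m : nat => m%:R : R)); rewrite natrD cardO.
  rewrite (_ : ~: _ = [set o : O n | `[< accepted n G o.1 o.2 >] == false]); last first.
    by apply/setP => o; rewrite !inE eqbF_neg.
  by move: (N * _) (#|_|%:R) (#|_|%:R) le6 (mulr_gt0 N0 ns0) => x y z; lra.
set rej := [set o : O n | ~~ `[< accepted n G o.1 o.2 >] ].
(* Rejection requires an expensive partition or an unrepresentative sample, each contributing at
   most 1/6. *)
suff rej3 : #|rej|%:R <= N * n%:R ^+ s / 3.
  rewrite probE ler_pdivlMr ?mulr_gt0 //.
  have := cardsC rej; move/(congr1 (fun m : nat => m%:R : R)); rewrite natrD cardO.
  rewrite (_ : ~: _ = [set o : O n | `[< accepted n G o.1 o.2 >] == true]); last first.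
    by apply/setP => o; rewrite !inE negbK eqb_id.
  by move: (N * _) (#|_|%:R) (#|_|%:R) rej3 => x y z; lra.
pose cost (ws : T.-tuple {set 'I_n}) : R := #|unkept k q (adj G) setT ws|%:R.
pose heavy := [set ws : T.-tuple {set 'I_n} | beta * n%:R < cost ws].
(* Markov's inequality for the expected cut. *)
have heavy6 : #|heavy|%:R <= N / 6.
  have bn0 : 0 < beta * n%:R by rewrite mulr_gt0.
  rewrite -(ler_pM2r bn0); apply: (@le_trans _ _ (\sum_ws cost ws)).
    rewrite (bigID (mem heavy)) /= ler_wpDr ?sumr_ge0 //.
    by rewrite mulr_natl -sumr_const; apply: ler_sum => ws; rewrite inE => /ltW.
  by apply: le_trans (HT _ _ (hk _ _ PG)) _; rewrite -/N; lra.
rewrite /rej (natr_card_pairs _ (fun ws t => ~~ `[< accepted n G ws t >])).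
apply: (@le_trans _ _ (\sum_ws ((ws \in heavy)%:R * n%:R ^+ s + n%:R ^+ s / 6))).
  apply: ler_sum => ws _; have [wsh|wsh] := boolP (ws \in heavy).
    rewrite mul1r -cardS; apply: ler_wpDr; first by rewrite divr_ge0.
    by rewrite ler_nat max_card.
  rewrite mul0r add0r; apply: le_trans (unrep ws); rewrite ler_nat; apply: subset_leq_card.
  apply/subsetP => t; rewrite !inE; apply: contra => rep; apply/asboolP.
  (* The tested graph with its own partition witnesses acceptance. *)
  exists G, ws; split=> // [|z]; last exact: rep_close.
  by rewrite (@sum_stat _ k q d _ ws (@adj_deg d n G)) leNgt; move: wsh; rewrite inE.
rewrite big_split /= -mulr_suml sumr_const -[X in _ + X]mulr_natl cardT -natr_sum.
have -> : (\sum_ws (ws \in heavy) = #|heavy|)%N by rewrite -sum1_card [RHS]big_mkcond; apply: eq_bigr => ws _; case: (_ \in _).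
have := ler_wpM2r (ltW ns0) heavy6; lra.
Qed.
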